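(* Let $k$ be a field, $\mathcal{T}$ a $k$-linear triangulated category and $\mathcal{S}$ a full subcategory (set of objects) of $\mathcal{T}$ such that: (1) for $S,T\in\mathcal{S}$, $\operatorname{Hom}(S,T)=k^{\delta_{S,T}}$ (i.e. $\operatorname{End}(S)=k$ and $\operatorname{Hom}(S,T)=0$ if $S\ne T$); (2) $\mathcal{S}$ generates $\mathcal{T}$ as a triangulated category; (3) $\operatorname{Hom}(S,T[n])=0$ for all $S,T\in\mathcal{S}$ and $n<0$. Let $\mathcal{T}^{\le 0}$ (resp. $\mathcal{T}^{>0}$) be the full subcategory of objects $N$ of $\mathcal{T}$ for which there is a sequence $0=M_r\to\cdots\to M_2\xrightarrow{f_2}M_1\xrightarrow{f_1}M_0=N$ such that each $\operatorname{cone}(f_i)$ is a finite direct sum of objects of the form $S[d]$ with $S\in\mathcal{S}$ and $d\ge 0$ (resp. $d<0$). Then $(\mathcal{T}^{\le 0},\mathcal{T}^{>0})$ is a bounded $t$-structure on $\mathcal{T}$.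
   Context: ''$\mathcal{S}$ generates $\mathcal{T}$ as a triangulated category'' means that the smallest full triangulated subcategory of $\mathcal{T}$ (closed under isomorphisms, shifts and cones) containing $\mathcal{S}$ is $\mathcal{T}$. That $(\mathcal{T}^{\le0},\mathcal{T}^{>0})$ is a $t$-structure means: $\operatorname{Hom}(X,Y)=0$ for $X\in\mathcal{T}^{\le0}$, $Y\in\mathcal{T}^{>0}$; $\mathcal{T}^{\le0}[1]\subseteq\mathcal{T}^{\le0}$ and $\mathcal{T}^{>0}\subseteq\mathcal{T}^{>0}[1]$; every $N\in\mathcal{T}$ sits in a distinguished triangle $X\to N\to Y\rightsquigarrow$ with $X\in\mathcal{T}^{\le 0}$, $Y\in\mathcal{T}^{>0}$. *)

(* Defs.v *)
From HB Require Import structures.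
From mathcomp Require Import all_boot all_order all_algebra.

Set Implicit Arguments.
Unset Strict Implicit.
Unset Printing Implicit Defensive.

Import GRing.Theory.
Local Open Scope ring_scope.

Reserved Notation "g \oc f" (at level 40, left associativity).

Record linearCategory (k : fieldType) := LinearCategory {
  obj :> Type;
  mor : obj -> obj -> lmodType k;
  idm : forall X, mor X X;
  compm : forall X Y Z, mor Y Z -> mor X Y -> mor X Z;
  comp_idl : forall X Y (f : mor X Y), compm (idm Y) f = f;
  comp_idr : forall X Y (f : mor X Y), compm f (idm X) = f;
  comp_assoc : forall W X Y Z (h : mor Y Z) (g : mor X Y) (f : mor W X),
    compm h (compm g f) = compm (compm h g) f;
  comp_linearl : forall X Y Z (f : mor X Y) (a : k) (g g' : mor Y Z),
    compm (a *: g + g') f = a *: compm g f + compm g' f;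
  comp_linearr : forall X Y Z (g : mor Y Z) (a : k) (f f' : mor X Y),
    compm g (a *: f + f') = a *: compm g f + compm g f'
}.

Arguments mor {k C} X Y : rename.
Arguments idm {k C} X : rename.
Arguments compm {k C X Y Z} g f : rename.
Notation "g \oc f" := (compm g f) : ring_scope.

Definition is_iso (k : fieldType) (C : linearCategory k) (X Y : C)
    (f : mor X Y) : Prop :=
  exists g : mor Y X, g \oc f = idm X /\ f \oc g = idm Y.

Definition isomorphic (k : fieldType) (C : linearCategory k) (X Y : C) : Prop :=
  exists f : mor X Y, is_iso f.

Definition is_zero_object (k : fieldType) (C : linearCategory k) (Z : C) : Prop :=
  forall X : C, (forall f : mor X Z, f = 0) /\ (forall f : mor Z X, f = 0).

Definition is_direct_sum (k : fieldType) (C : linearCategory k) (n : nat)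
    (A : 'I_n -> C) (P : C) : Prop :=
  exists (inj : forall i, mor (A i) P) (proj : forall i, mor P (A i)),
    [/\ forall i, proj i \oc inj i = idm (A i),
        forall i j, i != j -> proj j \oc inj i = 0
      & \sum_(i < n) inj i \oc proj i = idm P].

Record linearFunctor (k : fieldType) (C D : linearCategory k) := LinearFunctor {
  fobj :> C -> D;
  fmap : forall X Y : C, mor X Y -> mor (fobj X) (fobj Y);
  fmap_linear : forall (X Y : C) (a : k) (f g : mor X Y),
    fmap (a *: f + g) = a *: fmap f + fmap g;
  fmap1 : forall X : C, fmap (idm X) = idm (fobj X);
  fmap_comp : forall (X Y Z : C) (g : mor Y Z) (f : mor X Y),
    fmap (g \oc f) = fmap g \oc fmap f
}.

Arguments fmap {k C D} F {X Y} f : rename.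

Record autoequivalence (k : fieldType) (C : linearCategory k) := Autoequivalence {
  aeq_fun :> linearFunctor C C;
  aeq_inv : linearFunctor C C;
  aeq_unit : forall X : C, mor X (aeq_inv (aeq_fun X));
  aeq_counit : forall X : C, mor (aeq_fun (aeq_inv X)) X;
  aeq_unit_iso : forall X : C, is_iso (aeq_unit X);
  aeq_counit_iso : forall X : C, is_iso (aeq_counit X);
  aeq_unit_natural : forall (X Y : C) (f : mor X Y),
    aeq_unit Y \oc f = fmap aeq_inv (fmap aeq_fun f) \oc aeq_unit X;
  aeq_counit_natural : forall (X Y : C) (f : mor X Y),
    aeq_counit Y \oc fmap aeq_fun (fmap aeq_inv f) = f \oc aeq_counit X
}.

(* [tri_sums] is additivity; its case n = 0 provides a zero object. *)
Record triangulatedCategory (k : fieldType) := TriangulatedCategory {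
  tri_cat :> linearCategory k;
  tri_sums : forall (n : nat) (A : 'I_n -> tri_cat),
    exists P : tri_cat, is_direct_sum A P;
  tri_shift : autoequivalence tri_cat;
  (* [tri_dist f g h] : X -f-> Y -g-> Z -h-> X[1] is distinguished *)
  tri_dist : forall X Y Z : tri_cat,
    mor X Y -> mor Y Z -> mor Z (tri_shift X) -> Prop;
  TR1_id : forall X Z : tri_cat, is_zero_object Z ->
    tri_dist (idm X) (0 : mor X Z) (0 : mor Z (tri_shift X));
  TR1_iso : forall (X Y Z X' Y' Z' : tri_cat)
    (f : mor X Y) (g : mor Y Z) (h : mor Z (tri_shift X))
    (f' : mor X' Y') (g' : mor Y' Z') (h' : mor Z' (tri_shift X'))
    (u : mor X X') (v : mor Y Y') (w : mor Z Z'),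
    is_iso u -> is_iso v -> is_iso w ->
    v \oc f = f' \oc u -> w \oc g = g' \oc v ->
    fmap tri_shift u \oc h = h' \oc w ->
    tri_dist f g h -> tri_dist f' g' h';
  TR1_cone : forall (X Y : tri_cat) (f : mor X Y),
    exists (Z : tri_cat) (g : mor Y Z) (h : mor Z (tri_shift X)),
      tri_dist f g h;
  TR2 : forall (X Y Z : tri_cat)
    (f : mor X Y) (g : mor Y Z) (h : mor Z (tri_shift X)),
    tri_dist f g h <-> tri_dist g h (- fmap tri_shift f);
  TR3 : forall (X Y Z X' Y' Z' : tri_cat)
    (f : mor X Y) (g : mor Y Z) (h : mor Z (tri_shift X))
    (f' : mor X' Y') (g' : mor Y' Z') (h' : mor Z' (tri_shift X'))
    (u : mor X X') (v : mor Y Y'),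
    tri_dist f g h -> tri_dist f' g' h' -> v \oc f = f' \oc u ->
    exists w : mor Z Z',
      w \oc g = g' \oc v /\ fmap tri_shift u \oc h = h' \oc w;
  (* octahedral axiom for X -f-> Y -g-> Z, with cones Z' of f, X' of g and
     Y' of g \oc f *)
  TR4 : forall (X Y Z X' Y' Z' : tri_cat) (f : mor X Y) (g : mor Y Z)
    (f1 : mor Y Z') (f2 : mor Z' (tri_shift X))
    (g1 : mor Z X') (g2 : mor X' (tri_shift Y))
    (h1 : mor Z Y') (h2 : mor Y' (tri_shift X)),
    tri_dist f f1 f2 -> tri_dist g g1 g2 -> tri_dist (g \oc f) h1 h2 ->
    exists (u : mor Z' Y') (v : mor Y' X'),
      [/\ tri_dist u v (fmap tri_shift f1 \oc g2),
          u \oc f1 = h1 \oc g, h2 \oc u = f2,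
          v \oc h1 = g1 & g2 \oc v = fmap tri_shift f \oc h2]
}.

Arguments tri_dist {k T X Y Z} f g h : rename.

(* X[n]; negative shifts iterate the chosen quasi-inverse of [1]. *)
Definition shiftz (k : fieldType) (T : triangulatedCategory k) (n : int) (X : T) : T :=
  match n with
  | Posz m => iter m (tri_shift T) X
  | Negz m => iter m.+1 (aeq_inv (tri_shift T)) X
  end.

Definition is_cone (k : fieldType) (T : triangulatedCategory k) (X Y : T)
    (f : mor X Y) (Z : T) : Prop :=
  exists (g : mor Y Z) (h : mor Z (tri_shift T X)), tri_dist f g h.

(* Full subcategories are given by predicates on objects. *)

Definition triangulated_subcategory (k : fieldType) (T : triangulatedCategory k)
    (P : T -> Prop) : Prop :=
  [/\ forall Z : T, is_zero_object Z -> P Z,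
      forall X Y : T, isomorphic X Y -> P X -> P Y,
      forall (n : int) (X : T), P X -> P (shiftz n X)
    & forall (X Y Z : T) (f : mor X Y), is_cone f Z -> P X -> P Y -> P Z].

Definition generates (k : fieldType) (T : triangulatedCategory k)
    (S : T -> Prop) : Prop :=
  forall P : T -> Prop, triangulated_subcategory P ->
    (forall X : T, S X -> P X) -> forall X : T, P X.

(* The full subcategory A[n], closed under isomorphism. *)
Definition shift_subcategory (k : fieldType) (T : triangulatedCategory k)
    (A : T -> Prop) (n : int) (X : T) : Prop :=
  exists2 Y : T, A Y & isomorphic X (shiftz n Y).

Definition is_t_structure (k : fieldType) (T : triangulatedCategory k)
    (Tle Tgt : T -> Prop) : Prop :=
  [/\ forall X Y : T, Tle X -> Tgt Y -> forall f : mor X Y, f = 0,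
      forall X : T, shift_subcategory Tle 1 X -> Tle X,
      forall Y : T, Tgt Y -> shift_subcategory Tgt 1 Y
    & forall N : T, exists (X Y : T) (f : mor X N) (g : mor N Y)
        (h : mor Y (tri_shift T X)),
        [/\ Tle X, Tgt Y & tri_dist f g h]].

(* T^{<= n} = T^{<= 0}[-n] and T^{> m} = T^{> 0}[-m]. *)
Definition is_bounded (k : fieldType) (T : triangulatedCategory k)
    (Tle Tgt : T -> Prop) : Prop :=
  forall X : T, exists n m : int,
    shift_subcategory Tle (- n) X /\ shift_subcategory Tgt (- m) X.

Definition is_sum_of_shifts (k : fieldType) (T : triangulatedCategory k)
    (S : T -> Prop) (D : int -> bool) (C : T) : Prop :=
  exists (n : nat) (X : 'I_n -> T) (d : 'I_n -> int),
    [/\ forall i, S (X i), forall i, D (d i)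
      & is_direct_sum (fun i => shiftz (d i) (X i)) C].

(* [M] and [f] are total for convenience; only M_0, .., M_r and the arrows
   f i : M_{i+1} -> M_i with i < r matter. *)
Definition filtered_by_shifts (k : fieldType) (T : triangulatedCategory k)
    (S : T -> Prop) (D : int -> bool) (N : T) : Prop :=
  exists (r : nat) (M : nat -> T) (f : forall i, mor (M i.+1) (M i)),
    [/\ M 0%N = N, is_zero_object (M r)
      & forall i, (i < r)%N ->
          exists2 C : T, is_cone (f i) C & is_sum_of_shifts S D C].

Definition t_le0 (k : fieldType) (T : triangulatedCategory k) (S : T -> Prop) :
    T -> Prop :=
  filtered_by_shifts S (fun d : int => 0 <= d).

Definition t_gt0 (k : fieldType) (T : triangulatedCategory k) (S : T -> Prop) :
    T -> Prop :=
  filtered_by_shifts S (fun d : int => d < 0).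

(* Main.v *)
Require Import Defs.
From mathcomp Require Import all_boot all_order all_algebra.
From mathcomp Require Import zify.
From Stdlib Require Import Classical_Prop.

(** Write [star P Q] for the objects N in a triangle X -> N -> Y -> X[1] with X
    in P and Y in Q; the octahedral axiom makes it associative.  With A the
    shifts S[d], d >= 0, and B those with d < 0, every connecting morphism
    a -> b[1] with a in A, b in B is zero or an isomorphism by the Hom
    conditions on S, so an extension of a by b either splits, hence can be
    rewritten as an extension of b by a, or is zero.  Bubble sorting with this
    rule turns an iterated extension of objects of A and B, that is, an
    arbitrary object of T, into an extension of a B-filtered object by an
    A-filtered one. *)

Set Implicit Arguments.
Unset Strict Implicit.
Unset Printing Implicit Defensive.

Import Order.TTheory GRing.Theory.
Local Open Scope ring_scope.

(** * Composition, isomorphisms and zero objects in linear categories *)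

Section LinearCategory.

Context {k : fieldType} {C : linearCategory k}.
Implicit Types X Y Z : C.

Lemma comp0l X Y Z (f : mor X Y) : (0 : mor Y Z) \oc f = 0.
Proof.
(* Linearity with coefficient -1 turns the composite into minus itself plus itself. *)
have := comp_linearl f (-1) (0 : mor Y Z) 0.
by rewrite scaler0 addr0 scaleN1r addNr.
Qed.

Lemma comp0r X Y Z (g : mor Y Z) : g \oc (0 : mor X Y) = 0.
Proof.
have := comp_linearr g (-1) (0 : mor X Y) 0.
by rewrite scaler0 addr0 scaleN1r addNr.
Qed.

Lemma compDl X Y Z (f : mor X Y) (g g' : mor Y Z) :
  (g + g') \oc f = g \oc f + g' \oc f.
Proof. by have := comp_linearl f 1 g g'; rewrite !scale1r. Qed.

Lemma compDr X Y Z (g : mor Y Z) (f f' : mor X Y) :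
  g \oc (f + f') = g \oc f + g \oc f'.
Proof. by have := comp_linearr g 1 f f'; rewrite !scale1r. Qed.

Lemma compZl X Y Z a (f : mor X Y) (g : mor Y Z) :
  (a *: g) \oc f = a *: (g \oc f).
Proof. by have := comp_linearl f a g 0; rewrite !addr0 comp0l addr0. Qed.

Lemma compZr X Y Z a (g : mor Y Z) (f : mor X Y) :
  g \oc (a *: f) = a *: (g \oc f).
Proof. by have := comp_linearr g a f 0; rewrite !addr0 comp0r addr0. Qed.

Lemma compNl X Y Z (f : mor X Y) (g : mor Y Z) : (- g) \oc f = - (g \oc f).
Proof. by rewrite -!scaleN1r compZl. Qed.

Lemma compNr X Y Z (g : mor Y Z) (f : mor X Y) : g \oc (- f) = - (g \oc f).
Proof. by rewrite -!scaleN1r compZr. Qed.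

Lemma comp_sumr X Y Z n (g : mor Y Z) (f : 'I_n -> mor X Y) :
  g \oc (\sum_i f i) = \sum_i g \oc f i.
Proof. by apply: big_morph; [apply: compDr | apply: comp0r]. Qed.

Lemma comp_suml X Y Z n (f : mor X Y) (g : 'I_n -> mor Y Z) :
  (\sum_i g i) \oc f = \sum_i g i \oc f.
Proof.
by apply: (big_morph (fun u => u \oc f)); [move=> ? ?; apply: compDl | apply: comp0l].
Qed.

Lemma is_iso_id X : is_iso (idm X).
Proof. by exists (idm X); rewrite comp_idl. Qed.

Lemma is_iso_comp X Y Z (g : mor Y Z) (f : mor X Y) :
  is_iso g -> is_iso f -> is_iso (g \oc f).
Proof.
move=> [g' [g'g gg']] [f' [f'f ff']]; exists (f' \oc g').
by split; rewrite -comp_assoc [X in _ \oc X]comp_assoc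
  ?g'g ?ff' comp_idl.
Qed.

Lemma is_iso_opp X Y (f : mor X Y) : is_iso f -> is_iso (- f).
Proof.
by move=> [g [gf fg]]; exists (- g); rewrite !compNl !compNr !opprK.
Qed.

Lemma is_isoZ X Y a (f : mor X Y) : a != 0 -> is_iso f -> is_iso (a *: f).
Proof.
move=> a0 [g [gf fg]]; exists (a^-1 *: g).
by rewrite !compZl !compZr !scalerA mulVf // mulfV // !scale1r.
Qed.

Lemma isomorphic_refl X : isomorphic X X.
Proof. by exists (idm X); apply: is_iso_id. Qed.

Lemma isomorphic_sym X Y : isomorphic X Y -> isomorphic Y X.
Proof. by move=> [f [g [gf fg]]]; exists g, f. Qed.

Lemma isomorphic_trans Y X Z :
  isomorphic X Y -> isomorphic Y Z -> isomorphic X Z.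
Proof. by move=> [f fi] [g gi]; exists (g \oc f); apply: is_iso_comp. Qed.

Lemma is_iso_epi X Y Z (e : mor X Y) (f g : mor Y Z) :
  is_iso e -> f \oc e = g \oc e -> f = g.
Proof.
move=> [e' [_ ee']] /(congr1 (fun u => u \oc e')).
by rewrite -!comp_assoc ee' !comp_idr.
Qed.

Lemma is_iso_mono X Y Z (e : mor Y Z) (f g : mor X Y) :
  is_iso e -> e \oc f = e \oc g -> f = g.
Proof.
move=> [e' [e'e _]] /(congr1 (fun u => e' \oc u)).
by rewrite !comp_assoc e'e !comp_idl.
Qed.

Lemma id0_zero_object X : idm X = 0 -> is_zero_object X.
Proof.
move=> X0 Y; split=> f; first by rewrite -[f]comp_idl X0 comp0l.
by rewrite -[f]comp_idr X0 comp0r.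
Qed.

Lemma zero_object_iso X Y : isomorphic X Y -> is_zero_object X -> is_zero_object Y.
Proof.
move=> [f [g [gf fg]]] X0; apply: id0_zero_object.
by rewrite -fg (proj1 (X0 Y) g) comp0r.
Qed.

Definition orthogonal_objects X Y := forall f : mor X Y, f = 0.

Lemma orthogonal_iso X Y X' Y' : isomorphic X X' -> isomorphic Y Y' ->
  orthogonal_objects X Y -> orthogonal_objects X' Y'.
Proof.
move=> [u ui] [v vi] XY f; case: (vi) => v' [v'v vv'].
apply: (is_iso_epi ui); rewrite comp0l -[_ \oc u]comp_idl -vv' -comp_assoc.
by rewrite [v' \oc _]XY comp0r.
Qed.

End LinearCategory.

(** * Linear functors *)

Section LinearFunctor.

Context {k : fieldType} {C D : linearCategory k} (F : linearFunctor C D).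
Implicit Types X Y : C.

Lemma fmap0 X Y : fmap F (0 : mor X Y) = 0.
Proof.
have := fmap_linear F (-1) (0 : mor X Y) 0.
by rewrite scaler0 addr0 scaleN1r addNr.
Qed.

Lemma fmapN X Y (f : mor X Y) : fmap F (- f) = - fmap F f.
Proof. by have := fmap_linear F (-1) f 0; rewrite !scaleN1r fmap0 !addr0. Qed.

Lemma fmap_iso X Y (f : mor X Y) : is_iso f -> is_iso (fmap F f).
Proof.
by move=> [g [gf fg]]; exists (fmap F g); rewrite -!fmap_comp gf fg !fmap1.
Qed.

Lemma isomorphic_fobj X Y : isomorphic X Y -> isomorphic (F X) (F Y).
Proof. by move=> [f fi]; exists (fmap F f); apply: fmap_iso. Qed.

Lemma zero_fobj X : is_zero_object X -> is_zero_object (F X).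
Proof.
by move=> X0; apply: id0_zero_object; rewrite -fmap1 (proj1 (X0 X) (idm X)) fmap0.
Qed.

End LinearFunctor.

(** * Full faithfulness of an autoequivalence and of its iterates *)

Section Autoequivalence.

Context {k : fieldType} {C : linearCategory k} (F : autoequivalence C).
Implicit Types X Y : C.

Lemma fmap_faithful X Y (f g : mor X Y) : fmap F f = fmap F g -> f = g.
Proof.
move=> fg; apply: (is_iso_mono (aeq_unit_iso F Y)).
by rewrite !aeq_unit_natural fg.
Qed.

Lemma fmap_inv_faithful X Y (f g : mor X Y) :
  fmap (aeq_inv F) f = fmap (aeq_inv F) g -> f = g.
Proof.
move=> fg; apply: (is_iso_epi (aeq_counit_iso F X)).
by rewrite -!aeq_counit_natural fg.
Qed.

Lemma fmap_full X Y (g : mor (F X) (F Y)) : exists f : mor X Y, fmap F f = g.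
Proof.
have [v [vu uv]] := aeq_unit_iso F Y.
(* The preimage is forced by naturality of the unit; that [F] sends it to [g] is tested after
   applying the quasi-inverse, which is faithful. *)
exists (v \oc fmap (aeq_inv F) g \oc aeq_unit F X).
apply: fmap_inv_faithful; apply: (is_iso_epi (aeq_unit_iso F X)).
by rewrite -aeq_unit_natural !comp_assoc uv comp_idl.
Qed.

Lemma orthogonal_fobj X Y :
  orthogonal_objects X Y -> orthogonal_objects (F X) (F Y).
Proof. by move=> XY f; have [g <-] := fmap_full f; rewrite (XY g) fmap0. Qed.

Lemma unit_isomorphic X : isomorphic X (aeq_inv F (F X)).
Proof. by exists (aeq_unit F X); apply: aeq_unit_iso. Qed.

Lemma counit_isomorphic X : isomorphic (F (aeq_inv F X)) X.
Proof. by exists (aeq_counit F X); apply: aeq_counit_iso. Qed.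

Lemma iter_unit_isomorphic m X :
  isomorphic X (iter m (aeq_inv F) (iter m F X)).
Proof.
elim: m X => [|m IH] X; first exact: isomorphic_refl.
rewrite iterSr iterS; apply: (isomorphic_trans (IH X)).
(* A unit is inserted in the middle of the word; this second induction carries it through the outer
   copies of the quasi-inverse. *)
elim: m (iter m F X) {IH} => [|m IH] Y /=; first exact: unit_isomorphic.
exact/isomorphic_fobj/IH.
Qed.

Lemma iter_counit_isomorphic m X :
  isomorphic X (iter m F (iter m (aeq_inv F) X)).
Proof.
elim: m X => [|m IH] X; first exact: isomorphic_refl.
rewrite iterSr iterS; apply: (isomorphic_trans (IH X)).
elim: m (iter m (aeq_inv F) X) {IH} => [|m IH] Y /=.
  exact/isomorphic_sym/counit_isomorphic.
exact/isomorphic_fobj/IH.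
Qed.

End Autoequivalence.

(** * Exactness properties of distinguished triangles *)

Section Triangles.

Context {k : fieldType} {T : triangulatedCategory k}.
Local Notation shift := (tri_shift T).
Local Notation zero_object := (@is_zero_object k T).
Implicit Types (X Y Z W N : T) (P Q L : T -> Prop).

Lemma zero_object_exists : exists Z : T, is_zero_object Z.
Proof.
have A : 'I_0 -> T by case.
have [Z [i [p [_ _ idZ]]]] := tri_sums A.
by exists Z; apply: id0_zero_object; rewrite -idZ big_ord0.
Qed.

Lemma dist_cone_id X Z : is_zero_object Z ->
  tri_dist (0 : mor Z X) (idm X) (0 : mor X (shift Z)).
Proof.
move=> Z0; apply/TR2; rewrite fmap0 oppr0.
by apply: TR1_id; apply: zero_fobj.
Qed.

(** Mapping the triangle of [idm X] to the given one makes [g \oc f] factor through a zero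
    object. *)
Lemma dist_comp0 X Y Z (f : mor X Y) (g : mor Y Z) (h : mor Z (shift X)) :
  tri_dist f g h -> g \oc f = 0.
Proof.
move=> d; have [O O0] := zero_object_exists.
have [w [<- _]] := TR3 (TR1_id X O0) d (u := idm X) (v := f) erefl.
by rewrite comp0r.
Qed.

Lemma dist_factor_cone X Y Z W (f : mor X Y) (g : mor Y Z) (h : mor Z (shift X))
    (t : mor Y W) :
  tri_dist f g h -> t \oc f = 0 -> exists s : mor Z W, t = s \oc g.
Proof.
move=> d tf; have [O O0] := zero_object_exists.
have [|s [sg _]] := TR3 d (dist_cone_id W O0) (u := 0) (v := t).
  by rewrite tf comp0l.
by exists s; rewrite sg comp_idl.
Qed.

(** TR3 completes only the third map, so both triangles are rotated first; the lift then appears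
    shifted and is recovered by full faithfulness. *)
Lemma dist_lift X Y Z W (f : mor X Y) (g : mor Y Z) (h : mor Z (shift X))
    (t : mor W Y) :
  tri_dist f g h -> g \oc t = 0 -> exists s : mor W X, t = f \oc s.
Proof.
move=> d gt; have [O O0] := zero_object_exists.
have d1 := proj1 (TR2 _ _ _) (TR1_id W O0).
have [|w [_ tw]] := TR3 d1 (proj1 (TR2 _ _ _) d) (u := t) (v := 0).
  by rewrite gt comp0l.
have [s sw] := fmap_full w; exists s.
apply: (fmap_faithful (F := shift)); apply: oppr_inj.
by move: tw; rewrite -sw fmap1 compNr comp_idr compNl fmap_comp.
Qed.

Lemma zero_cone_iso X Y Z (f : mor X Y) (g : mor Y Z) (h : mor Z (shift X)) :
  tri_dist f g h -> is_zero_object Z -> is_iso f.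
Proof.
move=> d Z0; have [|s fs] := dist_lift (t := idm Y) d; first exact: (proj1 (Z0 Y)).
exists s; split=> //.
apply: (fmap_faithful (F := shift)); apply/eqP; rewrite -subr_eq0 -fmapN; apply/eqP.
have d3 := proj1 (TR2 _ _ _) (proj1 (TR2 _ _ _) d).
(* The shift of [s \oc f - idm X] is killed by the shift of [f], hence factors through [h], which
   vanishes because its source is zero. *)
have [|r ->] := dist_lift (t := fmap shift (s \oc f) + fmap shift (- idm X)) d3.
  rewrite compNl compDr -!fmap_comp comp_assoc -fs comp_idl compNr comp_idr.
  by rewrite fmapN subrr oppr0.
by rewrite (proj2 (Z0 _) h) comp0l.
Qed.

Lemma zero_source_iso X Y Z (f : mor X Y) (g : mor Y Z) (h : mor Z (shift X)) :
  tri_dist f g h -> is_zero_object X -> is_iso g.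
Proof.
by move=> /TR2 d X0; apply: (zero_cone_iso d); apply: zero_fobj.
Qed.

(** Invertibility of [h] forces [g = 0] and [f = 0]; then [idm Y] is killed by [g], so it factors
    through [f] and vanishes. *)
Lemma iso_connecting_zero X Y Z (f : mor X Y) (g : mor Y Z) (h : mor Z (shift X)) :
  tri_dist f g h -> is_iso h -> is_zero_object Y.
Proof.
move=> d hi; apply: id0_zero_object.
have d2 := proj1 (TR2 _ _ _) d; have d3 := proj1 (TR2 _ _ _) d2.
have g0 : g = 0 by apply: (is_iso_mono hi); rewrite comp0r (dist_comp0 d2).
have f0 : f = 0.
  apply: (fmap_faithful (F := shift)); apply: oppr_inj; apply: (is_iso_epi hi).
  by rewrite (dist_comp0 d3) fmap0 oppr0 comp0l.
by have [|s ->] := dist_lift (t := idm Y) d; rewrite ?g0 ?f0 comp0l.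
Qed.

(* The three signs come from rotating the triangle three times. *)
Lemma dist_shift X Y Z (f : mor X Y) (g : mor Y Z) (h : mor Z (shift X)) :
  tri_dist f g h <->
  tri_dist (- fmap shift f) (- fmap shift g) (- fmap shift h).
Proof. by split=> [/TR2/TR2/TR2|d] //; do 3!apply/TR2. Qed.

(** The automorphism [- idm] of the middle object absorbs the signs on [f] and [g]; the third sign
    goes into [h']. *)
Lemma dist_fmap X Y Z (f : mor X Y) (g : mor Y Z)
    (h : mor (shift Z) (shift (shift X))) :
  tri_dist (fmap shift f) (fmap shift g) h ->
  exists h' : mor Z (shift X), tri_dist f g h'.
Proof.
have [h' <-] := fmap_full h => d; exists (- h').
apply/dist_shift; rewrite fmapN opprK.
apply: (TR1_iso (is_iso_id _) (is_iso_opp (is_iso_id _)) (is_iso_id _) _ _ _ d).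
- by rewrite compNl comp_idl comp_idr.
- by rewrite comp_idl compNr compNl comp_idr opprK.
- by rewrite fmap1 comp_idl comp_idr.
Qed.

(** * Extensions of one class of objects by another, and their associativity *)

Definition star P Q N := exists X Y (f : mor X N) (g : mor N Y)
  (h : mor Y (shift X)), [/\ P X, Q Y & tri_dist f g h].

Lemma star_mono P P' Q Q' N : (forall X, P X -> P' X) -> (forall X, Q X -> Q' X) ->
  star P Q N -> star P' Q' N.
Proof.
move=> PP QQ [X [Y [f [g [h [PX QY d]]]]]].
by exists X, Y, f, g, h; split; [apply: PP | apply: QQ |].
Qed.

Lemma star_iso P Q N N' : isomorphic N N' -> star P Q N -> star P Q N'.
Proof.
move=> [u ui] [X [Y [f [g [h [PX QY d]]]]]]; have [v [vu uv]] := ui.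
exists X, Y, (u \oc f), (g \oc v), h; split=> //.
apply: (TR1_iso (is_iso_id _) ui (is_iso_id _) _ _ _ d).
- by rewrite comp_idr.
- by rewrite comp_idl -comp_assoc vu comp_idr.
- by rewrite fmap1 comp_idl comp_idr.
Qed.

Lemma star_zerol Q N : Q N -> star zero_object Q N.
Proof.
move=> QN; have [O O0] := zero_object_exists.
by exists O, N, 0, (idm N), 0; split=> //; apply: dist_cone_id.
Qed.

Lemma star_zeror P N : P N -> star P zero_object N.
Proof.
move=> PN; have [O O0] := zero_object_exists.
by exists N, O, (idm N), 0, 0; split=> //; apply: TR1_id.
Qed.

(** The octahedron on [X -> Y -> N] exhibits the cone of the composite as an extension of the two
    other cones. *)
Lemma star_assocr P Q L N : star (star P Q) L N -> star P (star Q L) N.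
Proof.
move=> [Y [X' [g [g1 [g2 [[X [Z' [f [f1 [f2 [PX QZ d]]]]]] LX d']]]]]].
have [Y' [h1 [h2 d2]]] := TR1_cone (g \oc f).
have [u [v [duv _ _ _ _]]] := TR4 d d' d2.
exists X, Y', (g \oc f), h1, h2; split=> //.
by exists Z', X', u, v, (fmap shift f1 \oc g2).
Qed.

(* Desuspension: the octahedral axiom for [N -> M -> X'] yields the shift of
   the wanted object. *)
Lemma star_assocl P Q L N : star P (star Q L) N -> star (star P Q) L N.
Proof.
move=> [X [M [f [g [h [PX [Z [X' [a [b [c [QZ LX db]]]]]] /TR2 dg]]]]]].
have {}db := proj1 (TR2 _ _ _) db.
have [Y' [h1 [h2 d2]]] := TR1_cone (b \oc g).
have [u [v [duv _ _ _ _]]] := TR4 dg db d2.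
have [e ei] := counit_isomorphic shift Y'; have [e' [e'e ee']] := ei.
have e'i : is_iso e' by exists e.
pose W := aeq_inv shift Y'.
have [w ew] := fmap_full (- (h2 \oc e)).
have [p ep] := fmap_full (e' \oc u).
have [q eq] := fmap_full (v \oc e).
have [r dpq] : exists r : mor Z (shift X), tri_dist p q r.
  apply: (@dist_fmap _ _ _ p q (fmap shift h \oc - fmap shift a)).
  apply: (TR1_iso (is_iso_id _) e'i (is_iso_id _) _ _ _ duv).
  - by rewrite ep comp_idr.
  - by rewrite eq comp_idl -comp_assoc ee' comp_idr.
  - by rewrite fmap1 comp_idl comp_idr.
exists W, X', w, (b \oc g), (e' \oc h1); split=> //; first by exists X, Z, p, q, r.
apply/TR2; apply: (TR1_iso (is_iso_id _) (is_iso_id _) e'i _ _ _ d2).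
- by rewrite comp_idl comp_idr.
- by rewrite comp_idr.
- by rewrite fmap1 comp_idl ew opprK -comp_assoc ee' comp_idr.
Qed.

(** The shift of the wanted triangle is compared with the given one along inverse counits, with a
    sign on the middle object as in [dist_fmap]. *)
Lemma dist_unshift X Y Z (f : mor X Y) (g : mor Y Z) (h : mor Z (shift X)) :
  tri_dist f g h -> exists h', tri_dist (fmap (aeq_inv shift) f)
    (fmap (aeq_inv shift) g) (h' : mor _ (shift (aeq_inv shift X))).
Proof.
move=> d; have [c [ecX eXc]] := aeq_counit_iso shift X.
have ci : is_iso c by exists (aeq_counit shift X).
have [h' eh] := fmap_full (fmap shift c \oc h \oc aeq_counit shift Z).
have [cY [ecY eYc]] := aeq_counit_iso shift Y.
have cYi : is_iso cY by exists (aeq_counit shift Y).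
have [cZ [ecZ eZc]] := aeq_counit_iso shift Z.
have cZi : is_iso cZ by exists (aeq_counit shift Z).
exists (- h'); apply/dist_shift; rewrite fmapN opprK eh.
apply: (TR1_iso ci (is_iso_opp cYi) cZi _ _ _ d).
- apply: (is_iso_mono (aeq_counit_iso shift Y)).
  rewrite !compNl !compNr !comp_assoc eYc comp_idl aeq_counit_natural.
  by rewrite -comp_assoc eXc comp_idr.
- apply: (is_iso_mono (aeq_counit_iso shift Z)).
  rewrite !compNl !compNr opprK !comp_assoc eZc comp_idl aeq_counit_natural.
  by rewrite -comp_assoc eYc comp_idr.
- by rewrite -!comp_assoc eZc comp_idr.
Qed.

(** A filtration read from its zero end, one cone at a time. Closure under isomorphism and under
    arbitrary extensions is derived below rather than built in. *)
Inductive ext_closure L : T -> Prop :=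
| ext_zero N : is_zero_object N -> ext_closure L N
| ext_cone M N C (f : mor M N) (g : mor N C) (h : mor C (shift M)) :
    ext_closure L M -> L C -> tri_dist f g h -> ext_closure L N.

Lemma ext_starr L N : star (ext_closure L) L N -> ext_closure L N.
Proof. by move=> [M [C [f [g [h [LM LC d]]]]]]; apply: ext_cone d. Qed.

Lemma ext_incl L N : L N -> ext_closure L N.
Proof.
move=> LN; apply: ext_starr; apply: star_mono (star_zerol LN) => // X.
exact: ext_zero.
Qed.

Lemma ext_mono L L' N : (forall C, L C -> L' C) ->
  ext_closure L N -> ext_closure L' N.
Proof.
move=> LL; elim=> {N} [N N0 | M N C f g h _ IH /LL LC d]; first exact: ext_zero.
exact: ext_cone d.
Qed.

Lemma ext_iso L N N' : isomorphic N N' -> ext_closure L N -> ext_closure L N'.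
Proof.
move=> NN LN; case: N / LN NN => [N N0 | M N C f g h LM LC d] NN.
  exact/ext_zero/(zero_object_iso NN N0).
by apply/ext_starr/(star_iso NN); exists M, C, f, g, h.
Qed.

Lemma ext_star L N : star (ext_closure L) (ext_closure L) N -> ext_closure L N.
Proof.
move=> [X [Y [f [g [h [LX LY d]]]]]].
elim: LY N f g h d => {Y} [Y Y0 | M Y C f' g' h' _ IH LC d'] N f g h d.
  by apply: ext_iso LX; exists f; apply: zero_cone_iso d Y0.
(* The singleton classes [eq X] and [eq M] remember the actual objects through reassociation, so
   that the induction hypothesis for [M] applies. *)
apply: ext_starr; have : star (star (eq X) (eq M)) L N.
  apply: star_assocl; exists X, Y, f, g, h; split=> //.
  by exists M, C, f', g', h'.
apply: star_mono => // W [X' [M' [f1 [g1 [h1 [eX eM d1]]]]]].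
subst X' M'; exact: IH d1.
Qed.

Lemma ext_fshift L L' N : (forall C, L C -> L' (shift C)) ->
  ext_closure L N -> ext_closure L' (shift N).
Proof.
move=> LL; elim=> {N} [N N0 | M N C f g h _ IH /LL LC /dist_shift d].
  exact/ext_zero/zero_fobj.
exact: ext_cone d.
Qed.

Lemma ext_unshift L L' N : (forall C, L C -> L' (aeq_inv shift C)) ->
  ext_closure L N -> ext_closure L' (aeq_inv shift N).
Proof.
move=> LL; elim=> {N} [N N0 | M N C f g h _ IH /LL LC /dist_unshift [h' d]].
  exact/ext_zero/zero_fobj.
exact: ext_cone d.
Qed.

(** Two successive inductions: weak cokernels reduce the source to a single factor in [L], then weak
    kernels reduce the target to one in [L']. *)
Lemma orthogonal_ext L L' X Y :
  (forall A B, L A -> L' B -> orthogonal_objects A B) ->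
  ext_closure L X -> ext_closure L' Y -> orthogonal_objects X Y.
Proof.
move=> LL LX LY; elim: LX => {X} [X X0 | M X C f g h _ IH LC d] t.
  exact: (proj2 (X0 Y)).
have [|s ->] := dist_factor_cone (t := t) d; first exact: IH.
suff /(_ s) -> : orthogonal_objects C Y by rewrite comp0l.
elim: LY => {Y IH t s} [Y Y0 | M' Y C' f' g' h' _ IH LC' d'] t.
  exact: (proj1 (Y0 C)).
have [|s ->] := dist_lift (t := t) d'; first exact: LL LC LC' _.
by rewrite (IH s) comp0r.
Qed.

(* [filtered (is_sum_of_shifts S D)] unfolds to [filtered_by_shifts S D]. *)
Definition filtered L N := exists (r : nat) (M : nat -> T)
  (f : forall i, mor (M i.+1) (M i)),
  [/\ M 0%N = N, is_zero_object (M r)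
    & forall i, (i < r)%N -> exists2 C : T, is_cone (f i) C & L C].

Lemma filteredP L N : filtered L N <-> ext_closure L N.
Proof.
split=> [[r [M [f [<- M0 fC]]]] | ].
  suff: forall i, (i <= r)%N -> ext_closure L (M (r - i)%N).
    by move=> /(_ r (leqnn r)); rewrite subnn.
  elim=> [_|i IH ir]; first by rewrite subn0; apply: ext_zero.
  have [|C [g [h d]] LC] := fC (r - i.+1)%N; first by rewrite ltn_subrL (leq_trans _ ir).
  (* The index [r - i] must become a successor for [M (r - i)] to be the source of the arrow in the
     triangle. *)
  move: (IH (ltnW ir)) g h d; rewrite -(subnSK ir) => LM g h d.
  exact: ext_cone LM LC d.
elim=> {N} [N N0 | M' N C f g h _ [r [M [F [eM M0 FC]]]] LC d].
  by exists 0%N, (fun=> N), (fun=> 0).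
subst M'; pose M' i := if i is j.+1 then M j else N.
pose F' i : mor (M' i.+1) (M' i) :=
  match i return mor (M' i.+1) (M' i) with 0%N => f | j.+1 => F j end.
exists r.+1, M', F'; split=> // -[_|i /FC //].
by exists C => //; exists g, h.
Qed.

(** The first summand is split off: the cone [Q] of its injection is a direct sum of the others,
    because the retraction [proj a] kills the connecting map and so makes [g] an epimorphism. *)
Lemma ext_sum L n (A : 'I_n -> T) N :
  is_direct_sum A N -> (forall i, ext_closure L (A i)) -> ext_closure L N.
Proof.
elim: n A N => [|n IH] A N [inj [proj [pi_id pi0 sumN]]] LA.
  by apply/ext_zero/id0_zero_object; rewrite -sumN big_ord0.
pose a := @ord0 n; have [Q [g [h d]]] := TR1_cone (inj a).
have d2 := proj1 (TR2 _ _ _) d; have d3 := proj1 (TR2 _ _ _) d2.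
have h0 : h = 0.
  rewrite -[h]comp_idl -fmap1 -(pi_id a) fmap_comp -comp_assoc.
  have /eqP := dist_comp0 d3; rewrite compNl oppr_eq0 => /eqP ->.
  by rewrite comp0r.
have g_epi W (u v : mor Q W) : u \oc g = v \oc g -> u = v.
  move=> ug; apply/eqP; rewrite -subr_eq0; apply/eqP.
  have [|s ->] := dist_factor_cone (t := u - v) d2.
    by rewrite compDl compNl ug subrr.
  by rewrite h0 comp0r.
have [|s sg] := dist_factor_cone (t := idm N - inj a \oc proj a) d.
  by rewrite compDl compNl comp_idl -comp_assoc pi_id comp_idr subrr.
have psg i : proj (lift a i) \oc s \oc g = proj (lift a i).
  rewrite -comp_assoc -sg compDr compNr comp_idr comp_assoc pi0 ?neq_lift //.
  by rewrite comp0l subr0.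
apply: ext_star; exists (A a), Q, (inj a), g, h; split=> //.
apply: (IH (fun i => A (lift a i))) => //.
exists (fun i => g \oc inj (lift a i)), (fun i => proj (lift a i) \oc s); split.
- by move=> i; rewrite comp_assoc psg.
- by move=> i j ij; rewrite comp_assoc psg pi0 // (inj_eq lift_inj).
- apply: g_epi; rewrite comp_suml comp_idl.
  under eq_bigr => i _ do rewrite -comp_assoc psg -comp_assoc.
  rewrite -comp_sumr; move: sumN; rewrite big_ord_recl => /(canRL (addKr _)) ->.
  rewrite addrC compDr compNr comp_assoc (dist_comp0 d) comp0l.
  by rewrite oppr0 addr0 comp_idr.
Qed.

(** A vanishing connecting map gives a section [s] of [g]. The octahedron on [p \oc f] places the
    cone of that map in a triangle with connecting map [- idm], so this cone is zero and [X] can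
    replace the cone of [s]. *)
Lemma dist_split X Y Z (f : mor X Y) (g : mor Y Z) :
  tri_dist f g 0 -> exists (f' : mor Z Y) (g' : mor Y X) h', tri_dist f' g' h'.
Proof.
move=> d; have [|s gs] := dist_lift (t := idm Z) (proj1 (TR2 _ _ _) d).
  by rewrite comp0l.
have [Q [p [q ds]]] := TR1_cone s.
have [Y' [h1 [h2 dp]]] := TR1_cone (p \oc f).
have [u [v [duv _ _ _ _]]] := TR4 d (proj1 (TR2 _ _ _) ds) dp.
have [e' [e'e ee']] : is_iso (p \oc f).
  apply: zero_cone_iso dp _; apply: iso_connecting_zero duv _.
  rewrite compNr -fmap_comp -gs fmap1; exact/is_iso_opp/is_iso_id.
exists s, (e' \oc p), (q \oc (p \oc f)).
apply: (TR1_iso (is_iso_id _) (is_iso_id _) _ _ _ _ ds (w := e')).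
- by exists (p \oc f).
- by rewrite comp_idl comp_idr.
- by rewrite comp_idr.
- by rewrite fmap1 comp_idl -comp_assoc ee' comp_idr.
Qed.

(** * Sorting iterated extensions *)

Lemma ext_swap A B N :
  (forall X Y (h : mor X (shift Y)), A X -> B Y -> h = 0 \/ is_iso h) ->
  ext_closure (fun C => A C \/ B C) N -> star (ext_closure A) (ext_closure B) N.
Proof.
move=> AB.
have swap : forall X Y M, A X -> B Y -> star (eq Y) (eq X) M ->
    star A B M \/ is_zero_object M.
  move=> X Y M AX BY [Y' [X' [f [g [h [eY eX d]]]]]]; subst X' Y'.
  have [h0|hi] := AB _ _ h AX BY; last by right; apply: iso_connecting_zero d hi.
  left; move: d; rewrite h0 => /dist_split [f' [g' [h' d]]].
  by exists X, Y, f', g', h'.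
(* When a swap cancels two factors, nothing from [A] remains, so the left slot must allow zero
   objects. *)
pose A0 := fun C => A C \/ is_zero_object C.
(* One factor from [A] moves left past a whole [B]-filtered object, by induction on its filtration:
   it is swapped with the last factor [b], then pushed through the rest [Y']. In the cancelling case
   only [Y'] is left. *)
have push : forall Y, ext_closure B Y -> forall X M, A X ->
    star (eq Y) (eq X) M -> star A0 (ext_closure B) M.
  move=> Y; elim=> {Y} [Y Y0 | Y' Y b f g h BY' IH Bb d] X M AX.
    move=> [Y1 [X1 [f [g [h [eY eX d]]]]]]; subst X1 Y1.
    apply: (@star_iso _ _ X).
      by apply: isomorphic_sym; exists g; apply: zero_source_iso d Y0.
    apply: star_mono (star_zeror AX) => ? ?; first by left.
    exact: ext_zero.
  move=> YX; have : star (eq Y') (star (eq b) (eq X)) M.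
    apply: star_assocr; apply: star_mono YX => // _ <-.
    by exists Y', b, f, g, h.
  move=> [Y1 [M' [f1 [g1 [h1 [eY /(swap _ _ _ AX Bb) bX d1]]]]]]; subst Y1.
  case: bX => [ABM|M'0]; last first.
    apply: (@star_iso _ _ Y').
      by exists f1; apply: zero_cone_iso d1 M'0.
    by apply: star_mono (star_zerol BY') => // ? ?; right.
  have : star (star (eq Y') A) B M by apply: star_assocl; exists Y', M', f1, g1, h1.
  move=> [W [b' [f2 [g2 [h2 [[Y1 [X' [f3 [g3 [h3 [eY AX' d3]]]]]] Bb' d2]]]]]].
  subst Y1; have W0 : star A0 (ext_closure B) W.
    by apply: IH AX' _; exists Y', X', f3, g3, h3.
  have : star A0 (star (ext_closure B) B) M.
    by apply: star_assocr; exists W, b', f2, g2, h2.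
  by apply: star_mono => // ?; apply: ext_starr.
elim=> {N} [N N0 | M N C f g h _ IH ABC d].
  by apply: star_mono (star_zeror N0) => ? ?; apply: ext_zero.
(* With [M] already sorted, a new factor [C] from [B] joins the [B]-part, while one from [A] is
   pushed through it into the [A]-part. *)
have : star (ext_closure A) (star (ext_closure B) (eq C)) N.
  by apply: star_assocr; exists M, C, f, g, h.
case: ABC => [AC|BC]; last first.
  apply: star_mono => // M' BM; apply: ext_starr.
  by apply: star_mono BM => // _ <-.
move=> AN; have : star (ext_closure A) (star A0 (ext_closure B)) N.
  apply: star_mono AN => // M' [Y [X [f1 [g1 [h1 [BY eX d1]]]]]]; subst X.
  by apply: push BY _ _ AC _; exists Y, C, f1, g1, h1.
move=> /star_assocl; apply: star_mono => // M' AM; apply: ext_star.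
apply: star_mono AM => // X [AX|X0]; first exact: ext_incl.
exact: ext_zero.
Qed.

End Triangles.

(** * Filtrations by shifts of the generators, and their degrees *)

Section Shifts.

Context {k : fieldType} {T : triangulatedCategory k}.
Local Notation shift := (tri_shift T).
Implicit Types (X Y N C : T) (S L : T -> Prop) (D : int -> bool).

Lemma ext_bind L L' N : (forall C, L C -> ext_closure L' C) ->
  ext_closure L N -> ext_closure L' N.
Proof.
move=> LL; elim=> {N} [N N0 | M N C f g h _ IH /LL LC d]; first exact: ext_zero.
by apply: ext_star; exists M, C, f, g, h.
Qed.

(** For [d >= 0] the two objects coincide; for [d < 0] a counit cancels one copy of the
    quasi-inverse. *)
Lemma shift_shiftz d X : isomorphic (shift (shiftz d X)) (shiftz (d + 1) X).
Proof.
case: d => [m|m].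
  by rewrite -PoszD addn1; apply: isomorphic_refl.
have -> : Negz m + 1 = - m%:Z by lia.
by case: m => [|m]; apply: counit_isomorphic.
Qed.

Lemma unshift_shiftz d X :
  isomorphic (aeq_inv shift (shiftz d X)) (shiftz (d - 1) X).
Proof.
apply: (isomorphic_trans (Y := aeq_inv shift (shift (shiftz (d - 1) X)))).
  apply: isomorphic_fobj; apply: isomorphic_sym.
  by have := shift_shiftz (d - 1) X; rewrite subrK.
exact/isomorphic_sym/unit_isomorphic.
Qed.

Lemma shiftzN m X : shiftz (- m%:Z) X = iter m (aeq_inv shift) X.
Proof. by case: m. Qed.

Definition shifts_of S D C :=
  exists X d, [/\ S X, D d & isomorphic C (shiftz d X)].

(** A cone that is a finite sum is refined into single shifts by [ext_sum]; conversely a single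
    shift is a sum with one term. *)
Lemma filtered_by_shiftsP S D N :
  filtered_by_shifts S D N <-> ext_closure (shifts_of S D) N.
Proof.
apply: iff_trans (filteredP (is_sum_of_shifts S D) N) _; split.
  apply: ext_bind => C [n [X [d [SX Dd sumC]]]].
  apply: (ext_sum sumC) => i; apply: ext_incl.
  by exists (X i), (d i); split=> //; apply: isomorphic_refl.
apply: ext_mono => C [X [d [SX Dd [u [v [vu uv]]]]]].
exists 1%N, (fun=> X), (fun=> d); split=> //.
exists (fun=> v), (fun=> u); split=> //; last by rewrite big_ord1.
by move=> i j; rewrite !ord1.
Qed.

Lemma ext_iter_shift S D D' m N : (forall d, D d -> D' (d + m%:Z)) ->
  ext_closure (shifts_of S D) N ->
  ext_closure (shifts_of S D') (iter m shift N).
Proof.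
elim: m D' => [|m IH] D' DD LN /=.
  apply: ext_mono LN => C [X [d [SX Dd Ci]]]; exists X, d; split=> //.
  by have := DD _ Dd; rewrite addr0.
apply: (@ext_fshift _ _ (shifts_of S (fun d => D' (d + 1)))); last first.
  by apply: IH LN => d /DD; rewrite -addrA -PoszD addn1.
move=> C [X [d [SX Dd Ci]]]; exists X, (d + 1); split=> //.
exact: isomorphic_trans (isomorphic_fobj _ Ci) (shift_shiftz _ _).
Qed.

Lemma ext_iter_unshift S D D' m N : (forall d, D d -> D' (d - m%:Z)) ->
  ext_closure (shifts_of S D) N ->
  ext_closure (shifts_of S D') (iter m (aeq_inv shift) N).
Proof.
elim: m D' => [|m IH] D' DD LN /=.
  apply: ext_mono LN => C [X [d [SX Dd Ci]]]; exists X, d; split=> //.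
  by have := DD _ Dd; rewrite subr0.
apply: (@ext_unshift _ _ (shifts_of S (fun d => D' (d - 1)))); last first.
  by apply: IH LN => d /DD; rewrite -addrA -opprD -PoszD addn1.
move=> C [X [d [SX Dd Ci]]]; exists X, (d - 1); split=> //.
exact: isomorphic_trans (isomorphic_fobj _ Ci) (unshift_shiftz _ _).
Qed.

Lemma ext_generated S : generates S ->
  forall N, ext_closure (shifts_of S xpredT) N.
Proof.
apply; last by move=> X SX; apply: ext_incl; exists X, 0; split=> //;
  apply: isomorphic_refl.
split=> [Z|X Y|[m|m] X LX|X Y Z f [g [h /TR2 d]] LX LY].
- exact: ext_zero.
- exact: ext_iso.
- exact: ext_iter_shift LX.
- exact: (ext_iter_unshift (m := m.+1) _ LX).
(* Rotation shows the cone as an extension of [Y] by [shift X]. *)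
- apply: ext_star; exists Y, (shift X), g, h, (- fmap shift f); split=> //.
  exact: (ext_iter_shift (m := 1) _ LX).
Qed.

Lemma ext_shifts_bounded S N : ext_closure (shifts_of S xpredT) N ->
  exists m : nat, ext_closure (shifts_of S (fun d => - m%:Z <= d < m%:Z)) N.
Proof.
elim=> {N} [N N0 | M N C f g h _ [m LM] [X [d [SX _ Ci]]] dist].
  by exists 0%N; apply: ext_zero.
(* The successor is needed because the upper bound on degrees is strict. *)
exists (maxn m `|d|.+1); apply: ext_cone dist.
  by apply: ext_mono LM => B [Y [e [SY le_e Bi]]]; exists Y, e; split=> //; lia.
by exists X, d; split=> //; lia.
Qed.

End Shifts.

(** * Morphisms between shifts of objects of [S] *)

Section Simples.

Context {k : fieldType} {T : triangulatedCategory k}.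
Context {S : T -> Prop}.
Context (S_end : forall X : T, S X -> bijective (fun a : k => a *: idm X)).
Context (S_orth : forall X Y : T, S X -> S Y -> X <> Y ->
  forall f : mor X Y, f = 0).
Context (S_neg : forall (X Y : T) (n : int), S X -> S Y -> n < 0 ->
  forall f : mor X (shiftz n Y), f = 0).
Local Notation shift := (tri_shift T).

(** Removing one shift from both sides at a time reduces to [S_neg], since the difference of degrees
    stays negative. *)
Lemma orthogonal_shifts X Y (m : nat) (e : int) : S X -> S Y -> e < m%:Z ->
  orthogonal_objects (shiftz m%:Z X) (shiftz e Y).
Proof.
move=> SX SY; elim: m e => [|m IH] e em; first exact: S_neg.
apply: orthogonal_iso (isomorphic_refl _) _ (orthogonal_fobj (F := shift) (IH (e - 1) _)).
  by have := shift_shiftz (e - 1) Y; rewrite subrK.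
by lia.
Qed.

(** This is Schur's lemma; excluded middle decides whether the two objects are equal. *)
Lemma simple_mor_iso X Y (h : mor X Y) : S X -> S Y -> h = 0 \/ is_iso h.
Proof.
move=> SX SY; have [eXY|nXY] := classic (X = Y); last by left; apply: S_orth.
subst Y; have [c _ ch] := S_end SX; rewrite -(ch h).
have [->|c0] := eqVneq (c h) 0; first by left; rewrite scale0r.
by right; apply: is_isoZ => //; apply: is_iso_id.
Qed.

Lemma connecting_zero_or_iso X Y (h : mor X (shift Y)) :
  shifts_of S (fun d => 0 <= d) X -> shifts_of S (fun d => d < 0) Y ->
  h = 0 \/ is_iso h.
Proof.
move=> [X0 [[m|m] [SX // _ Xi]]] [Y0 [e [SY e0 Yi]]].
have {}Yi := isomorphic_trans (isomorphic_fobj shift Yi) (shift_shiftz e Y0).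
have [em|me] := ltP (e + 1) m%:Z.
  left; apply: orthogonal_iso (isomorphic_sym Xi) (isomorphic_sym Yi) _ h.
  exact: orthogonal_shifts.
(* As [e + 1 <= 0 <= m], the only case not covered by orthogonality has both degrees zero, where
   Schur's lemma applies. *)
have [m0 e1] : m = 0%N /\ e + 1 = 0 by lia.
subst m; rewrite e1 in Yi; have [[u ui] [v vi]] := (Xi, Yi).
have [u' [u'u uu']] := ui; have u'i : is_iso u' by exists u.
have [v' [v'v vv']] := vi; have v'i : is_iso v' by exists v.
have -> : h = v' \oc (v \oc h \oc u') \oc u.
  by rewrite !comp_assoc v'v comp_idl -comp_assoc u'u comp_idr.
have [->|wi] := simple_mor_iso (v \oc h \oc u') SX SY.
  by left; rewrite comp0r comp0l.
by right; do 2!apply: is_iso_comp => //.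
Qed.

End Simples.

(** * Verification of the t-structure axioms and of boundedness *)

Theorem proposition3p4 (k : fieldType) (T : triangulatedCategory k)
    (S : T -> Prop)
    (S_end : forall X : T, S X -> bijective (fun a : k => a *: idm X))
    (S_orth : forall X Y : T, S X -> S Y -> X <> Y ->
       forall f : mor X Y, f = 0)
    (S_gen : generates S)
    (S_neg : forall (X Y : T) (n : int), S X -> S Y -> n < 0 ->
       forall f : mor X (shiftz n Y), f = 0) :
  is_t_structure (t_le0 S) (t_gt0 S) /\ is_bounded (t_le0 S) (t_gt0 S).
Proof.
split=> [|N]; last first.
  have [m LN] := ext_shifts_bounded (ext_generated S_gen N).
  (* All degrees of [N] lie in [[-m, m)]: shifting up by [m] makes them nonnegative, shifting down
     by [m] makes them negative. *)
  exists m%:Z, (- m%:Z); rewrite opprK; split.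
    exists (iter m (tri_shift T) N); last first.
      by rewrite shiftzN; apply: iter_unit_isomorphic.
    by apply/filtered_by_shiftsP; apply: ext_iter_shift LN => d /=; lia.
  exists (iter m (aeq_inv (tri_shift T)) N); last exact: iter_counit_isomorphic.
  by apply/filtered_by_shiftsP; apply: ext_iter_unshift LN => d /=; lia.
split.
- move=> X Y /filtered_by_shiftsP LX /filtered_by_shiftsP LY.
  apply: orthogonal_ext LX LY => A B [X0 [[m|m] [SX // _ Ai]]] [Y0 [e [SY /= e0 Bi]]].
  apply: orthogonal_iso (isomorphic_sym Ai) (isomorphic_sym Bi) _.
  by apply: (orthogonal_shifts S_neg) => //; lia.
- move=> X [Y /filtered_by_shiftsP LY XY]; apply/filtered_by_shiftsP.
  apply: ext_iso (isomorphic_sym XY) _.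
  by apply: (ext_iter_shift (m := 1) _ LY) => d /=; lia.
- move=> Y /filtered_by_shiftsP LY; exists (aeq_inv (tri_shift T) Y).
    apply/filtered_by_shiftsP.
    by apply: (ext_iter_unshift (m := 1) _ LY) => d /=; lia.
  exact/isomorphic_sym/counit_isomorphic.
- move=> N; have [] : star (t_le0 S) (t_gt0 S) N; last first.
    by move=> X [Y [f [g [h [LX LY d]]]]]; exists X, Y, f, g, h.
  apply: (@star_mono _ _ (ext_closure (shifts_of S (fun d => 0 <= d))) _
    (ext_closure (shifts_of S (fun d => d < 0)))) => [X|X|].
  + by move/filtered_by_shiftsP.
  + by move/filtered_by_shiftsP.
  (* By generation [N] is an iterated extension of shifts; the sign of the degree assigns each
     factor to one of the two classes to be sorted. *)
  apply: ext_swap => [X Y h|]; first exact: connecting_zero_or_iso.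
  apply: ext_mono (ext_generated S_gen N) => C [X [d [SX _ Ci]]].
  by have [d0|d0] := leP 0 d; [left | right]; exists X, d.
Qed.
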